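(* (1) Suppose $\mathcal{L} = (P, L, I)$ is a partial linear space and $G$ is an abelian subgroup of $\operatorname{Aut}\mathcal{L}$ such that the action of $G$ is regular on both points and lines. Then for any point $p \in P$ and line $\ell \in L$, the set \[ S = \{ g \in G : p^g \in \ell \} \] is a Sidon set in $G$. (2) Conversely, suppose $G$ is an abelian group (written additively) and $S \subset G$. Let $\operatorname{dev}(S)$ be the incidence structure $(P, L, I)$ with $P = L = G$ and \[ I = \{(p, \ell) \in G \times G : p - \ell \in S\}. \] Then $\operatorname{dev}(S)$ is a partial linear space if and only if $S$ is a Sidon set. Moreover, every point of $\operatorname{dev}(S)$ is contained in $|S|$ lines, every line contains $|S|$ points, and $G$ (acting by translation on both $P = G$ and $L = G$) acts regularly on both points and lines.
   Context: An incidence structure $\mathcal{L} = (P, L, I)$ is a triple of sets with $I \subset P \times L$; elements of $P$ are called points, elements of $L$ lines, and $p \in \ell$ (read ''$p$ is incident with $\ell$'', ''$\ell$ contains $p$'') means $(p,\ell) \in I$. It is a partial linear space if any two distinct points are incident with at most one common line. A morphism (collineation) between incidence structures $(P,L,I)$ and $(P',L',I')$ is a pair of maps $P \to P'$, $L \to L'$ (both denoted $\phi$) such that $p \in \ell$ implies $p^\phi \in \ell^\phi$; an isomorphism is a morphism with an inverse morphism; $\operatorname{Aut}\mathcal{L}$ is the group of automorphisms of $\mathcal{L}$. For a group $G$ acting on a set $X$, $x^g$ denotes the image of $x\in X$ under $g \in G$; the action is regular if for all $x,y \in X$ there is exactly one $g \in G$ with $x^g = y$. A subset $S$ of an abelian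 group $G$ (written additively) is a Sidon set if for all $x,y,z,w \in S$, $x+y=z+w$ implies $\{x,y\}=\{z,w\}$ (and analogously, with $xy = zw$, if $G$ is written multiplicatively). *)

(* Defs.v *)
From HB Require Import structures.
From mathcomp Require Import all_boot all_algebra.
From mathcomp Require Import all_classical.

Set Implicit Arguments.
Unset Strict Implicit.
Unset Printing Implicit Defensive.

Local Open Scope classical_set_scope.

Record incidence := Incidence {
  ipoint : Type;
  iline : Type;
  inc : ipoint -> iline -> Prop }.

Definition partial_linear_space (X : incidence) :=
  forall (p q : ipoint X) (l m : iline X), p <> q ->
    inc p l -> inc q l -> inc p m -> inc q m -> l = m.

Record morphism (X Y : incidence) := Morphism {
  on_point : ipoint X -> ipoint Y;
  on_line : iline X -> iline Y;
  on_inc : forall p l, inc p l -> inc (on_point p) (on_line l) }.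

Lemma morphism_eq X Y (f g : morphism X Y) :
  on_point f = on_point g -> on_line f = on_line g -> f = g.
Proof.
case: f g => [fp fl fi] [gp gl gi] /= ep el; subst.
by congr Morphism; exact: Prop_irrelevance.
Qed.

Definition idm X : morphism X X :=
  @Morphism X X id id (fun _ _ h => h).

(* f first, then g, so that x^(fg) = (x^f)^g *)
Definition compm X Y Z (f : morphism X Y) (g : morphism Y Z) : morphism X Z :=
  @Morphism X Z (on_point g \o on_point f) (on_line g \o on_line f)
    (fun _ _ h => on_inc g (on_inc f h)).

(* The inverse morphism is kept as data; as it is unique, it does not affect
   equality of automorphisms (lemma aut_eq). *)
Record aut (X : incidence) := Aut {
  aut_mor :> morphism X X;
  aut_inv : morphism X X;
  autK : compm aut_mor aut_inv = idm X;
  autVK : compm aut_inv aut_mor = idm X }.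

Section AutGroup.
Variable X : incidence.

Lemma compmA (f g h : morphism X X) :
  compm f (compm g h) = compm (compm f g) h.
Proof. exact: morphism_eq. Qed.

Lemma comp1m (f : morphism X X) : compm (idm X) f = f.
Proof. exact: morphism_eq. Qed.

Lemma compm1 (f : morphism X X) : compm f (idm X) = f.
Proof. exact: morphism_eq. Qed.

Lemma aut_eq (f g : aut X) : aut_mor f = aut_mor g -> f = g.
Proof.
case: f g => [f f' fK fVK] [g g' gK gVK] /= e; subst g.
have e' : f' = g' by rewrite -[f']compm1 -gK compmA fVK comp1m.
subst g'; congr Aut; exact: Prop_irrelevance.
Qed.

Definition aut_one : aut X := @Aut X (idm X) (idm X) (comp1m _) (comp1m _).

Fact aut_mul_subproof (f g : aut X) :
  compm (compm f g) (compm (aut_inv g) (aut_inv f)) = idm X.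
Proof. by rewrite compmA -(compmA f) autK compm1 autK. Qed.

Fact aut_mulV_subproof (f g : aut X) :
  compm (compm (aut_inv g) (aut_inv f)) (compm f g) = idm X.
Proof. by rewrite compmA -(compmA (aut_inv g)) autVK compm1 autVK. Qed.

Definition aut_mul (f g : aut X) : aut X :=
  Aut (aut_mul_subproof f g) (aut_mulV_subproof f g).

Definition aut_inverse (f : aut X) : aut X := Aut (autVK f) (autK f).

Fact aut_mulA : associative aut_mul.
Proof. by move=> f g h; apply: aut_eq; exact: compmA. Qed.

Fact aut_mul1l : left_id aut_one aut_mul.
Proof. by move=> f; apply: aut_eq; exact: comp1m. Qed.

Fact aut_mul1r : right_id aut_one aut_mul.
Proof. by move=> f; apply: aut_eq; exact: compm1. Qed.

Fact aut_mulVl : left_inverse aut_one aut_inverse aut_mul.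
Proof. by move=> f; apply: aut_eq; exact: autVK. Qed.

Fact aut_mulVr : right_inverse aut_one aut_inverse aut_mul.
Proof. by move=> f; apply: aut_eq; exact: autK. Qed.

HB.instance Definition _ := gen_eqMixin (aut X).
HB.instance Definition _ := gen_choiceMixin (aut X).
HB.instance Definition _ := isGroup.Build (aut X)
  aut_mulA aut_mul1l aut_mul1r aut_mulVl aut_mulVr.

End AutGroup.

Definition regular (T A : Type) (act : T -> A -> T) (G : set A) :=
  forall x y : T, exists! g : A, G g /\ act x g = y.

(* The law is a parameter: additive and multiplicative groups are distinct
   structures in the library. *)
Definition Sidon (T : Type) (op : T -> T -> T) (S : set T) :=
  forall x y z w : T, S x -> S y -> S z -> S w ->
    op x y = op z w -> [set x; y] = [set z; w].

Definition dev (G : zmodType) (S : set G) : incidence :=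
  @Incidence G G (fun p l => S (p - l)%R).

(* Main.v *)
(** Write the abelian group additively, identifying it with the orbit of p. If g
    lies in S then g + y lies on the translate of the line by y. So if
    x + y = z + w in S with x <> z, the two distinct points z + y and
    x + y = z + w lie on both the y-translate and the z-translate of the line;
    hence y = z. Conversely, if p <> q both lie on l and m in dev(S), the Sidon
    property applied to (p - l) + (q - m) = (q - l) + (p - m) gives l = m. *)
Require Import Defs.
From HB Require Import structures.
From mathcomp Require Import all_boot all_algebra.
From mathcomp Require Import all_classical.

Set Implicit Arguments.
Unset Strict Implicit.
Unset Printing Implicit Defensive.

Import GRing.Theory.

Local Open Scope classical_set_scope.
Local Open Scope card_scope.

(** Regularity makes any single point, or line, tell the elements of the group apart. *)
Lemma regular_inj (T A : Type) (act : T -> A -> T) (G : set A) (x : T) (g h : A) :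
  regular act G -> G g -> G h -> act x g = act x h -> g = h.
Proof.
move=> reg Gg Gh e; have [k [_ k_uniq]] := reg x (act x h).
by rewrite -(k_uniq g) // (k_uniq h).
Qed.

Lemma orbit_Sidon (X : incidence) (G : groupClosed (aut X)) (p : ipoint X)
    (l : iline X) :
  partial_linear_space X ->
  {in G &, forall g h : aut X, commute g h} ->
  regular (fun (p : ipoint X) (g : aut X) => on_point g p) [set` G] ->
  regular (fun (l : iline X) (g : aut X) => on_line g l) [set` G] ->
  Sidon (fun g h : aut X => (g * h)%g)
    [set g : aut X | g \in G /\ inc (on_point g p) l].
Proof.
move=> plsX comG regP regL x y z w [Gx xl] [Gy yl] [Gz zl] [Gw wl] exy.
have [exz|nxz] := pselect (x = z).
  by subst z; rewrite (mulgI _ _ _ exy).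
have eyz : y = z.
  (* By regularity on lines it suffices that [y] and [z] send [l] to the same line, which holds once
     two distinct points lie on both images. *)
  apply: (@regular_inj _ _ _ _ l y z regL Gy Gz).
  apply: (plsX (on_point (z * y)%g p) (on_point (x * y)%g p)).
  - move=> e; apply/nxz/esym/(mulIg y).
    by apply: (regular_inj regP _ _ e); exact: gpredM.
  - exact: on_inc zl.
  - exact: on_inc xl.
  (* A product acts by its left factor first, so incidence with the image of [l] under [z] needs [z]
     as the last factor; commutativity moves it there, here and in the next case. *)
  - by rewrite -(comG y z Gy Gz); exact: on_inc yl.
  - by rewrite exy (comG z w Gz Gw); exact: on_inc wl.
subst z; have -> : x = w by apply: (mulIg y); rewrite exy; exact: comG.
exact: setUC.
Qed.

Lemma dev_plsP (G : zmodType) (S : set G) :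
  partial_linear_space (dev S) <-> Sidon (fun g h : G => (g + h)%R) S.
Proof.
split=> [plsS x y z w Sx Sy Sz Sw exy | sidS p q l m npq /= pl ql pm qm].
  have [exz|nxz] := pselect (x = z).
    by subst z; rewrite (@addrI G x y w exy).
  have eyz : y = z.
    (* The differences of these two points with the lines [y] and [z] are [z], [x], [y] and [w], all
       in [S]. *)
    apply: (plsS (z + y)%R (x + y)%R) => /=.
    - by move=> /addIr /esym.
    - by rewrite addrK.
    - by rewrite addrK.
    - by rewrite addrC addKr.
    - by rewrite exy addrC addKr.
  subst z; have -> : x = w by apply: (@addIr G y); rewrite exy addrC.
  exact: setUC.
have /(sidS _ _ _ _ pl qm ql pm) e : (p - l + (q - m) = q - l + (p - m))%R.
  by rewrite addrACA [RHS]addrACA (addrC p).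
(* So [p - l] is [q - l] or [p - m]: the first contradicts [npq], the second gives [l = m]. *)
have : [set (q - l)%R; (p - m)%R] (p - l)%R by rewrite -e; left.
by case=> /= [/addIr|/addrI/oppr_inj].
Qed.

(** The involution [s] to [p - s] carries [S] onto the lines through [p]. Equipotence also covers
    infinite [S]. *)
Lemma dev_card_lines (G : zmodType) (S : set G) (p : G) :
  [set l : G | S (p - l)%R] #= S.
Proof.
have -> : [set l : G | S (p - l)%R] = (fun s => p - s)%R @` S.
  apply/seteqP; split=> [l Sl|_ [s Ss <-]] /=; last by rewrite subKr.
  by exists (p - l)%R; rewrite ?subKr.
by apply: inj_card_eq => s t _ _ /addrI/oppr_inj.
Qed.

Lemma dev_card_points (G : zmodType) (S : set G) (l : G) :
  [set p : G | S (p - l)%R] #= S.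
Proof.
have -> : [set p : G | S (p - l)%R] = (fun s => s + l)%R @` S.
  apply/seteqP; split=> [p Sp|_ [s Ss <-]] /=; last by rewrite addrK.
  by exists (p - l)%R; rewrite ?subrK.
by apply: inj_card_eq => s t _ _ /addIr.
Qed.

Lemma translation_regular (G : zmodType) :
  regular (fun x g : G => (x + g)%R) [set: G].
Proof.
move=> x y; exists (y - x)%R; split; first by rewrite /= addrC subrK.
by move=> g [_ <-]; rewrite addrC addKr.
Qed.

Fact translation_inc (G : zmodType) (S : set G) (g p l : G) :
  S (p - l)%R -> S (p + g - (l + g))%R.
Proof. by rewrite opprD addrACA subrr addr0. Qed.

Definition dev_translation (G : zmodType) (S : set G) (g : G) :
    morphism (dev S) (dev S) :=
  @Morphism (dev S) (dev S) (fun p : G => p + g)%R (fun l : G => l + g)%R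
    (@translation_inc G S g).

(** This makes translation by [- g] the inverse morphism that [aut] requires, and makes translation
    a homomorphism. *)
Fact dev_translationD (G : zmodType) (S : set G) (g h : G) :
  compm (dev_translation S g) (dev_translation S h) = dev_translation S (g + h)%R.
Proof. by apply: morphism_eq; apply/funext => x; rewrite /= addrA. Qed.

Fact dev_translation0 (G : zmodType) (S : set G) :
  dev_translation S 0%R = idm (dev S).
Proof. by apply: morphism_eq; apply/funext => x; rewrite /= addr0. Qed.

Fact dev_translationK (G : zmodType) (S : set G) (g : G) :
  compm (dev_translation S g) (dev_translation S (- g)%R) = idm (dev S).
Proof. by rewrite dev_translationD subrr dev_translation0. Qed.

Fact dev_translationVK (G : zmodType) (S : set G) (g : G) :
  compm (dev_translation S (- g)%R) (dev_translation S g) = idm (dev S).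
Proof. by rewrite dev_translationD addNr dev_translation0. Qed.

Definition dev_translation_aut (G : zmodType) (S : set G) (g : G) :
    aut (dev S) :=
  Aut (dev_translationK S g) (dev_translationVK S g).

Theorem proposition2p1 :
  (forall (X : incidence) (G : groupClosed (aut X)),
     partial_linear_space X ->
     {in G &, forall g h : aut X, commute g h} ->
     regular (fun (p : ipoint X) (g : aut X) => on_point g p) [set` G] ->
     regular (fun (l : iline X) (g : aut X) => on_line g l) [set` G] ->
     forall (p : ipoint X) (l : iline X),
       Sidon (fun g h : aut X => (g * h)%g)
         [set g : aut X | g \in G /\ inc (on_point g p) l])
  /\
  (forall (G : zmodType) (S : set G),
     [/\ partial_linear_space (dev S) <-> Sidon (fun g h : G => (g + h)%R) S,
         forall p : ipoint (dev S), [set l : iline (dev S) | inc p l] #= S,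
         forall l : iline (dev S), [set p : ipoint (dev S) | inc p l] #= S
       & exists tau : G -> aut (dev S),
         [/\ forall g h : G, tau (g + h)%R = (tau g * tau h)%g,
             forall (g : G) (p : ipoint (dev S)),
               on_point (tau g) p = ((p : G) + g)%R,
             forall (g : G) (l : iline (dev S)),
               on_line (tau g) l = ((l : G) + g)%R,
             regular (fun (p : ipoint (dev S)) (g : G) => on_point (tau g) p)
               [set: G]
           & regular (fun (l : iline (dev S)) (g : G) => on_line (tau g) l)
               [set: G]]]).
Proof.
split=> [X G plsX comG regP regL p l | G S]; first exact: orbit_Sidon.
split; first exact: dev_plsP.
- exact: dev_card_lines.
- exact: dev_card_points.
exists (@dev_translation_aut G S); split=> //.
- by move=> g h; apply: aut_eq; rewrite /= dev_translationD.
(* On points and on lines alike the action unfolds to [x + g] in [G], so one lemma serves both. *)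
- exact: translation_regular.
- exact: translation_regular.
Qed.
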